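(* Let $d\geq 1$ and let $\sigma$ be a sign pattern of length $d+1$ (beginning with $+$). If $\sigma$ is canonical, then $\sigma$ is of type 2.
   Context: All polynomials are real, univariate, monic, with all coefficients nonvanishing. Such a polynomial is a hyperbolic polynomial (HP) if all its roots are real. A sign pattern (SP) of length $d+1$ is a sequence of $d+1$ signs $+$ or $-$ beginning with $+$. The SP of $P=\sum_{j=0}^d a_jx^j$ ($a_d=1$, all $a_j\in\mathbb{R}\setminus\{0\}$) is $\sigma(P)=(+,\mathrm{sgn}(a_{d-1}),\ldots,\mathrm{sgn}(a_0))$; we say that $P$ realizes $\sigma(P)$. By Descartes' rule of signs, an HP has exactly as many positive (resp. negative) roots, counted with multiplicity, as there are sign changes (resp. sign preservations) between consecutive signs of $\sigma(P)$. Change-preservation pattern (CPP): to an SP of length $d+1$ one associates the word of length $d$ in the letters $c,p$ whose $j$-th letter ($1\le j\le d$) is $p$ if the signs in positions $j$ and $j+1$ of the SP are equal and $c$ if they are different. Canonical order: read the CPP of $\sigma$ from right to left and replace each $p$ by $N$ and each $c$ by $P$, obtaining a word $(w_1,\ldots,w_d)$. An HP realizing $\sigma$ whose roots have pairwise distinct moduli $0<\gamma_1<\cdots<\gamma_d$ has canonical order of the moduli of its roots if, for each $i$, the root of modulus $\gamma_i$ is positive when $w_i=P$ and negative when $w_i=N$. An SP $\sigma$ is canonical if every HP that realizes $\sigma$ and whose roots have pairwise distinct moduli has canonical order of the moduli of its roots. For positive integers $m_1,\ldots,m_s$ with $m_1+\cdots+m_s=d+1$, $\Sigma_{m_1,\ldots,m_s}$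 denotes the SP consisting of $m_1$ signs $+$, followed by $m_2$ signs $-$, followed by $m_3$ signs $+$, etc. Every SP is uniquely of this form. The SP $\Sigma_{m_1,\ldots,m_s}$ is of type 2 if (i) there is no $i$ with $1\le i\le s-1$ such that both $m_i>1$ and $m_{i+1}>1$, and (ii) $m_i\neq 2$ for all $2\leq i\leq s-1$ (while $m_1=2$ and/or $m_s=2$ is allowed). *)

(* Defs.v *)
From mathcomp Require Import all_boot all_order all_algebra.
From mathcomp Require Import complex reals.

Set Implicit Arguments.
Unset Strict Implicit.
Unset Printing Implicit Defensive.

Import Order.TTheory GRing.Theory Num.Theory.

Local Open Scope ring_scope.

(* Encodings by booleans: a sign is [true] for + and [false] for -; a letter
   of a change-preservation pattern is [true] for c and [false] for p; a letter
   of an order of moduli is [true] for P and [false] for N. *)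

Definition is_sign_pattern (d : nat) (sigma : seq bool) : Prop :=
  size sigma = d.+1 /\ head false sigma = true.

(* A polynomial coerces to the list a_0, ..., a_d of its coefficients, whereas
   sign patterns start with the sign of the leading coefficient. *)
Definition sign_pattern_of (R : realType) (P : {poly R}) : seq bool :=
  [seq 0 < a | a <- rev P].

Definition hyperbolic (R : realType) (P : {poly R}) : Prop :=
  [/\ P \is monic,
      all (fun a : R => a != 0) P &
      forall z : R[i], root (map_poly (real_complex R) P) z ->
        exists x : R, z = real_complex R x].

Definition change_preservation (sigma : seq bool) : seq bool :=
  pairmap (fun a b : bool => a != b) (head true sigma) (behead sigma).

(* With the encodings above, replacing p by N and c by P is the identity. *)
Definition canonical_word (sigma : seq bool) : seq bool :=
  rev (change_preservation sigma).

(* [rs] lists all the roots of [P], with multiplicity, and their moduli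
   satisfy 0 < gamma_1 < ... < gamma_d; such a list is unique, and it exists
   for a [P] that is [hyperbolic] exactly when the moduli
   of its roots are pairwise distinct. *)
Definition roots_by_modulus (R : realType) (P : {poly R}) (rs : seq R) : Prop :=
  P = \prod_(x <- rs) ('X - x%:P) /\
  path (fun x y : R => x < y) 0 [seq `|x| | x <- rs].

Definition canonical_order (R : realType) (sigma : seq bool) (rs : seq R) :
  Prop := [seq 0 < x | x <- rs] = canonical_word sigma.

Definition canonical (R : realType) (sigma : seq bool) : Prop :=
  forall (P : {poly R}) (rs : seq R),
    hyperbolic P -> sign_pattern_of P = sigma ->
    roots_by_modulus P rs -> canonical_order sigma rs.

(* Blocks are numbered from 0 here, so the even ones consist of signs +. *)
Definition Sigma (m : seq nat) : seq bool :=
  flatten [seq nseq (nth 0%N m i) (~~ odd i) | i <- iota 0 (size m)].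

(* [nth 0 m i] is m_{i+1} in the usual numbering from 1. *)
Definition type2 (sigma : seq bool) : Prop :=
  exists m : seq nat,
    [/\ all (fun k : nat => (0 < k)%N) m,
        sigma = Sigma m,
        forall i : nat, (i.+1 < size m)%N ->
          ~ ((1 < nth 0%N m i)%N /\ (1 < nth 0%N m i.+1)%N) &
        forall i : nat, (0 < i)%N -> (i.+1 < size m)%N -> nth 0%N m i <> 2%N].

(* Main.v *)
Require Import Defs.
From mathcomp Require Import all_boot all_order all_algebra.
From mathcomp Require Import complex reals.
From mathcomp Require Import ring lra.

(** The failure of type 2 is a local condition. Two adjacent blocks of length
    at least 2 give four consecutive signs [b, b, ~~ b, ~~ b], and an interior
    block of length 2 gives four consecutive signs [~~ b, b, b, ~~ b]; in terms
    of changes and preservations these are the factors pcp and cpc. So it is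
    enough to show that a sign pattern with such a factor is realized by a
    hyperbolic polynomial whose roots are not in canonical order.

    For the four signs alone, (x - 2)(x + 3)(x + 4) = x^3 + 5 x^2 - 2 x - 24 and
    its image under x -> -x do this ([misordered_four]): the canonical order
    would put the root 2 between the two others.

    A realization extends to longer patterns by concatenation. Multiplying by
    X - x with |x| tiny perturbs the old coefficients slightly and creates a new
    constant term ([misordered_rcons]); multiplying by 1 - y X with |y| tiny
    does the same at the other end and creates a new leading term
    ([misordered_cons]). The new root x, respectively 1/y, is smaller,
    respectively larger, in modulus than all others, and the new sign is a
    change exactly when this root is positive. Hence the canonical word gains,
    at the matching end, exactly the letter of the new root, and a violation of
    the canonical order among the old roots survives. *)

Set Implicit Arguments.
Unset Strict Implicit.
Unset Printing Implicit Defensive.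

Import Order.TTheory GRing.Theory Num.Theory.

Local Open Scope ring_scope.

(** * Signs under small perturbations *)

Definition has_sign (R : realType) (b : bool) (a : R) : bool :=
  if b then 0 < a else a < 0.

Lemma has_sign_neq0 (R : realType) b (a : R) : has_sign b a -> a != 0.
Proof. by case: b => /= h; [rewrite gt_eqF | rewrite lt_eqF]. Qed.

Lemma has_signN (R : realType) b (a : R) :
  has_sign (~~ b) (- a) = has_sign b a.
Proof. by case: b; rewrite /= ?oppr_lt0 ?oppr_gt0. Qed.

Lemma has_sign_perturb (R : realType) b (a e : R) :
  has_sign b a -> `|e| < `|a| -> has_sign b (a + e).
Proof.
case: b => /= ha; first by rewrite (gtr0_norm ha) ltr_norml => /andP[*]; lra.
by rewrite (ltr0_norm ha) ltr_norml => /andP[*]; lra.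
Qed.

Lemma small_pos (R : realType) (s : seq R) :
  all (fun a => 0 < a) s -> exists2 e : R, 0 < e & all (fun a => e < a) s.
Proof.
elim: s => [_|a s IHs /= /andP[a0 /IHs[e e0 es]]]; first by exists 1.
exists (Num.min e (a / 2)); first by rewrite lt_min e0 /=; lra.
apply/andP; split; first by rewrite gt_min; apply/orP; right; lra.
by apply: sub_all es => x ex; rewrite gt_min ex.
Qed.

(** The bound on [e] is what makes a coefficient [p] dominate the correction
    [y * q] coming from its neighbour; adding 1 to the denominator keeps it
    meaningful when [q] is zero. *)
Lemma small_factor (R : realType) (e p q y : R) :
  e < `|p| / (1 + `|q|) -> `|y| = e -> `|y * q| < `|p|.
Proof.
move=> + ye; rewrite normrM ye ltr_pdivlMr; last by apply: ltr_pwDl.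
have : 0 <= e by rewrite -ye.
by rewrite mulrDr mulr1; lra.
Qed.

(** * Realizations that violate the canonical order *)

(** The leading coefficient [k] is arbitrary, and the pattern may start with
    either sign, so that the property passes to factors and to opposite
    patterns; [misordered_not_canonical] normalizes [k] to 1. *)
Definition misordered (R : realType) (sigma : seq bool) : Prop :=
  exists (k : R) (rs : seq R),
    [/\ size sigma = (size rs).+1,
        path (fun x y : R => x < y) 0 [seq `|x| | x <- rs],
        forall i, (i < size sigma)%N ->
          has_sign (nth true (rev sigma) i)
                   (k *: \prod_(x <- rs) ('X - x%:P))`_i &
        [seq 0 < x | x <- rs] <> canonical_word sigma].

Lemma canonical_word_cons b c s :
  canonical_word (b :: c :: s) = rcons (canonical_word (c :: s)) (b != c).
Proof. by rewrite /canonical_word /change_preservation /= rev_cons. Qed.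

Lemma canonical_word_rcons b c s :
  canonical_word (rcons (rcons s c) b)
    = (c != b) :: canonical_word (rcons s c).
Proof.
rewrite /canonical_word /change_preservation.
case: s => [|a s] //=.
by rewrite -(cats1 (rcons s c)) pairmap_cat last_rcons /= rev_cat.
Qed.

Lemma canonical_word_negb s :
  canonical_word [seq ~~ b | b <- s] = canonical_word s.
Proof.
rewrite /canonical_word /change_preservation; case: s => [|a s] //=.
by congr rev; elim: s a => [|b s IHs] a //=; rewrite IHs; case: a; case: b.
Qed.

Lemma misordered_negb (R : realType) s :
  misordered R s -> misordered R [seq ~~ b | b <- s].
Proof.
case=> k [rs [sz prs sgn ord]]; exists (- k), rs.
split; rewrite ?size_map ?canonical_word_negb // => i lti.
rewrite -map_rev (nth_map true) ?size_rev // scaleNr coefN has_signN.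
exact: sgn.
Qed.

(** A root [x] of tiny modulus [e] is added: the coefficients of
    [('X - x%:P) * Q] are [- x * Q`_0] and the [Q`_i - x * Q`_i.+1]. *)
Lemma misordered_rcons (R : realType) s b :
  misordered R s -> misordered R (rcons s b).
Proof.
case/lastP: s => [|s c] [k [rs [sz prs sgn ord]]] //.
set Q := k *: _ in sgn.
have modpos : all (fun a => 0 < a) [seq `|x| | x <- rs].
  by apply: order_path_min prs; apply: lt_trans.
pose ratio i := `|Q`_i| / (1 + `|Q`_i.+1|).
have [] := @small_pos R ([seq ratio i | i <- iota 0 (size rs).+1]
                           ++ [seq `|x| | x <- rs]).
  rewrite all_cat modpos andbT all_map; apply/allP => i.
  rewrite mem_iota add0n => /andP[_ lti] /=.
  apply: divr_gt0; last by apply: ltr_pwDl.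
  by rewrite normr_gt0; apply: (has_sign_neq0 (sgn i _)); rewrite sz.
move=> e e0; rewrite all_cat => /andP[ratio_e mod_e].
pose x : R := if c != b then e else - e.
have nx : `|x| = e.
  by rewrite /x; case: ifP => _; rewrite ?normrN gtr0_norm.
have sx : (0 < x) = (c != b).
  by rewrite /x; case: ifP => _; rewrite ?e0 // oppr_gt0 ltNge (ltW e0).
exists k, (x :: rs); split.
- by rewrite size_rcons sz.
- rewrite /= nx e0 path_sortedE; last exact: lt_trans.
  by rewrite mod_e (path_sorted prs).
- move=> i; rewrite big_cons scalerAr -/Q mulrBl coefB coefXM coefCM.
  rewrite size_rcons rev_rcons; case: i => [_|i] /=.
    have /= := sgn 0%N; rewrite sz rev_rcons /= => /(_ isT).
    rewrite sub0r /x; case: (b); case: (c) => /=; nra.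
  rewrite ltnS => lti; apply: has_sign_perturb; first exact: sgn.
  rewrite normrN; apply: small_factor nx.
  move: ratio_e; rewrite all_map => /allP /(_ i); apply.
  by rewrite mem_iota add0n -sz.
- by rewrite /= canonical_word_rcons sx => -[].
Qed.

(** A root [y^-1] of huge modulus is added: the coefficients of [Q * (1 - y X)]
    are [Q`_0] and the [Q`_i.+1 - y * Q`_i], the last of them being the new
    leading coefficient [- y * lead_coef Q]. Taking [y] as the small parameter
    keeps the old coefficients in place. *)
Lemma misordered_cons (R : realType) s b :
  misordered R s -> misordered R (b :: s).
Proof.
case: s => [|c s] [k [rs [sz prs sgn ord]]] //.
set Q := k *: _ in sgn.
have modpos : all (fun a => 0 < a) [seq `|x| | x <- rs].
  by apply: order_path_min prs; apply: lt_trans.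
pose ratio i := `|Q`_i.+1| / (1 + `|Q`_i|).
have [] := @small_pos R ([seq ratio i | i <- iota 0 (size rs)]
                           ++ [seq a^-1 | a <- [seq `|x| | x <- rs]]).
  rewrite all_cat; apply/andP; split; last first.
    by rewrite all_map; apply: sub_all modpos => a /=; rewrite invr_gt0.
  rewrite all_map; apply/allP => i.
  rewrite mem_iota add0n => /andP[_ lti] /=.
  apply: divr_gt0; last by apply: ltr_pwDl.
  by rewrite normr_gt0; apply: (has_sign_neq0 (sgn i.+1 _)); rewrite sz.
move=> e e0; rewrite all_cat => /andP[ratio_e mod_e].
pose y : R := if b != c then e else - e.
have ny : `|y| = e.
  by rewrite /y; case: ifP => _; rewrite ?normrN gtr0_norm.
have sy : (0 < y) = (b != c).
  by rewrite /y; case: ifP => _; rewrite ?e0 // oppr_gt0 ltNge (ltW e0).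
have y0 : y != 0 by rewrite -normr_eq0 ny gt_eqF.
have szQ : (size Q <= size (c :: s))%N.
  rewrite sz; apply: leq_trans (size_scale_leq _ _) _.
  by rewrite size_prod_XsubC.
exists (- y * k), (rcons rs y^-1); split.
- by rewrite size_rcons /= -sz.
- rewrite map_rcons rcons_path prs /= normfV ny.
  have := mem_last 0 [seq `|x| | x <- rs]; rewrite inE => /predU1P[->|].
    by rewrite invr_gt0.
  move: mod_e modpos; rewrite all_map => /allP mod_e /allP modpos lst.
  rewrite -[ltLHS]invrK ltf_pV2 ?posrE ?invr_gt0 //; first exact: mod_e.
  exact: modpos.
- move=> i; rewrite [(i < _)%N]ltnS leq_eqVlt.
  (* The scalar [- y] turns the factor [X - y^-1] into [1 - y X]. *)
  have -> : (- y * k) *: \prod_(x <- rcons rs y^-1) ('X - x%:P)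
            = Q - y *: (Q * 'X).
    rewrite -cats1 big_cat big_seq1 /= mulrBr scalerBr [_ * _%:P]mulrC mul_polyC.
    rewrite scalerA mulNr [in X in _ - X]mulNr mulrAC mulfV // mul1r.
    by rewrite !scaleNr opprK addrC /Q -scalerAl scalerA.
  rewrite coefB (coefZ y) coefMX rev_cons nth_rcons size_rev => /orP[/eqP->|lti].
    rewrite ltnn eqxx nth_default //.
    have szs : size s = size rs by case: sz.
    have szlt : (size rs < size (c :: s))%N by rewrite sz.
    have := sgn _ szlt; rewrite nth_rev // sz subnn -szs /= sub0r /y.
    by move: e0; case: (b); case: (c) => /=; nra.
  rewrite lti; apply: has_sign_perturb; first exact: sgn.
  rewrite normrN; case: i lti => [|i] lti.
    by rewrite mulr0 normr0 normr_gt0; apply: (has_sign_neq0 (sgn _ lti)).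
  apply: small_factor ny.
  move: ratio_e; rewrite all_map => /allP /(_ i); apply.
  by move: lti; rewrite mem_iota add0n; case: sz => <-.
- rewrite map_rcons canonical_word_cons invr_gt0 sy => /rcons_inj[].
  by [].
Qed.

Lemma misordered_infix (R : realType) s1 s s2 :
  misordered R s -> misordered R (s1 ++ s ++ s2).
Proof.
move=> ms; elim: s1 => [|b s1 IH] /=; last exact: misordered_cons.
elim/last_ind: s2 => [|s2 b IH]; first by rewrite cats0.
by rewrite -rcons_cat; apply: misordered_rcons.
Qed.

(** Both forbidden factors at once: [b = true] gives [+ + - -] and [b = false]
    gives [+ - - +]. A single positive root [a] with negative roots [- b'] and
    [- c'] realizes [+ + - -] as soon as [b' c' / (b' + c') < a < b' + c'], which
    leaves room for [a] to be the smallest modulus; 2, 3, 4 is such a choice. *)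
Lemma misordered_four (R : realType) (b : bool) :
  misordered R [:: true; b; false; ~~ b].
Proof.
pose e : R := if b then 1 else -1.
have e2 : e * e = 1 by rewrite /e; case: (b); lra.
exists 1, [:: 2 * e; - 3 * e; - 4 * e]; split => //=.
- rewrite /e; case: (b); rewrite ?mulr1 ?mulrN1 ?opprK ?normrN ?gtr0_norm; lra.
- rewrite scale1r !big_cons big_nil mulr1.
  have -> : ('X - (2 * e)%:P) * (('X - (- 3 * e)%:P) * ('X - (- 4 * e)%:P))
     = Poly [:: - 24 * e; - 2; 5 * e; 1].
    rewrite /= !cons_poly_def mul0r add0r.
    have -> : - 2 = - 2 * (e * e) by rewrite e2 mulr1.
    have -> : - 24 * e = - 24 * e * (e * e) by rewrite e2 mulr1.
    rewrite !(polyCM, polyCN, polyC_natr); ring.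
  move=> i; rewrite coef_Poly /rev /= /e.
  by case: i => [|[|[|[|i]]]] //=; case: (b) => /=; lra.
- by rewrite /e; case: (b); rewrite /canonical_word /=; case; lra.
Qed.

(** * Blocks of signs *)

Lemma Sigma_cons k m :
  Sigma (k :: m) = nseq k true ++ [seq ~~ b | b <- Sigma m].
Proof.
rewrite /Sigma /= (iotaDl 1 0) -map_comp map_flatten -map_comp.
congr (_ ++ flatten _); apply: eq_map => i /=.
by rewrite map_nseq.
Qed.

Lemma misordered_adjacent (R : realType) m i :
  (i.+1 < size m)%N -> (1 < nth 0%N m i)%N -> (1 < nth 0%N m i.+1)%N ->
  misordered R (Sigma m).
Proof.
elim: m i => [|a m IHm] [|i] //=.
  case: m {IHm} => [|b m] //= _.
  case: a => [|[|a]] // _; case: b => [|[|b]] // _.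
  (* The two last signs of the first block and the two first of the second. *)
  rewrite !Sigma_cons -[in nseq a.+2 _]addn2 nseqD -catA map_cat /=.
  exact: (@misordered_infix R _ [:: true; true; false; false] _
            (misordered_four R true)).
rewrite ltnS Sigma_cons => lti ai bi; rewrite -[X in _ ++ X]cats0.
by apply/misordered_infix/misordered_negb/(IHm i).
Qed.

Lemma misordered_interior2 (R : realType) m i :
  all (fun k => 0 < k)%N m -> (i.+2 < size m)%N -> nth 0%N m i.+1 = 2%N ->
  misordered R (Sigma m).
Proof.
elim: m i => [|a m IHm] [|i] //= /andP[a0 m0].
  case: m {IHm} m0 => [|b [|c m]] //= /and3P[_ c0 _] _ ->.
  case: a a0 => // a _; case: c c0 => // c _.
  (* The block of length 2 together with the sign on either side of it. *)
  rewrite !Sigma_cons -[in nseq a.+1 _]addn1 nseqD -catA /=.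
  exact: (@misordered_infix R _ [:: true; false; false; true] _
            (misordered_four R false)).
rewrite ltnS Sigma_cons => lti ai; rewrite -[X in _ ++ X]cats0.
by apply/misordered_infix/misordered_negb/(IHm i).
Qed.

(** Normalizing the first sign to [true] makes the induction work: stripping it
    leaves a pattern of the same kind, possibly negated. *)
Lemma Sigma_surj (b : bool) (s : seq bool) :
  exists2 m, all (fun k => 0 < k)%N m &
    [seq a == b | a <- b :: s] = Sigma m.
Proof.
elim: s b => [|c s IHs] b; first by exists [:: 1%N]; rewrite //= eqxx.
have [[//|k m] /andP[k0 m0] em] := IHs c; rewrite Sigma_cons in em.
have [<-{b}|cb] := eqVneq c b.
  by exists (k.+1 :: m) => //; rewrite Sigma_cons /= -em /= eqxx.
exists (1%N :: k :: m); first by rewrite /= k0.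
rewrite Sigma_cons Sigma_cons -em -map_comp /= !eqxx (negPf cb).
congr [:: _, _ & _]; apply: eq_map => a /=.
by case: a b c cb {IHs em} => [] [] [].
Qed.

(** * Type 2 is necessary *)

Lemma misordered_not_canonical (R : realType) s :
  head false s = true -> misordered R s -> ~ canonical R s.
Proof.
move=> s1 [k [rs [sz prs sgn ord]]] can.
set P := \prod_(x <- rs) ('X - x%:P) in sgn.
have szP : size P = size s by rewrite /P size_prod_XsubC sz.
have mP : P \is monic by apply: monic_prod_XsubC.
have k0 : 0 < k.
  have szlt : (size rs < size s)%N by rewrite sz.
  have := sgn _ szlt; rewrite nth_rev // sz subnn.
  have -> : nth true s 0 = true by case: (s) s1.
  move/monicP: mP; rewrite lead_coefE szP sz coefZ => -> /=.
  by rewrite mulr1.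
have sgnP i : (i < size s)%N -> has_sign (nth true (rev s) i) P`_i.
  by move/sgn; rewrite coefZ; case: nth => /=; rewrite ?pmulr_rgt0 ?pmulr_rlt0.
apply/ord/(can P); [split| |split] => //.
- apply/(all_nthP 0) => i; rewrite szP => /sgnP; exact: has_sign_neq0.
- move=> z; rewrite /P rmorph_prod /=.
  rewrite (eq_bigr (fun x => 'X - (real_complex R x)%:P)); last first.
    by move=> x _; rewrite rmorphB /= map_polyX map_polyC.
  rewrite -(big_map (real_complex R) xpredT (fun x => 'X - x%:P)).
  by rewrite root_prod_XsubC => /mapP[x _ ->]; exists x.
- rewrite /sign_pattern_of map_rev -[RHS]revK; congr rev.
  apply: (@eq_from_nth _ true) => [|i]; rewrite size_map szP ?size_rev // => lti.
  rewrite (nth_map 0) ?szP //; have := sgnP i lti.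
  by case: nth => //= h; rewrite ltNge ltW.
Qed.

Theorem theorem2 (R : realType) (d : nat) (hd : (1 <= d)%N)
    (sigma : seq bool) (hsigma : is_sign_pattern d sigma) :
  canonical R sigma -> type2 sigma.
Proof.
case: hsigma => _ head1 can.
have absurd : ~ misordered R sigma.
  by move=> mis; exact: (misordered_not_canonical head1 mis can).
case: sigma head1 {can} absurd => [//|b s] /= -> absurd.
have [m m0 em] := Sigma_surj true s.
have {}em : true :: s = Sigma m.
  by rewrite -em -[LHS]map_id; apply: eq_map => -[].
rewrite em in absurd *; exists m; split=> //.
- by move=> i lti [mi mi1]; case: (absurd (misordered_adjacent R lti mi mi1)).
- case=> [|i] // _ lti mi.
  by case: (absurd (misordered_interior2 R m0 lti mi)).
Qed.
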